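(* Let $Y$ be a geodesic metric space. The following are equivalent: (1) $Y$ is quasi-isometric to some simplicial tree $\Gamma$. (2) (Bottleneck Property) There is some $\Delta>0$ so that for all $x,y\in Y$ there is a midpoint $m=m(x,y)$ with $d(x,m)=d(y,m)=\frac12 d(x,y)$ and the property that any path from $x$ to $y$ must pass within less than $\Delta$ of the point $m$.
   Context: A simplicial tree is regarded as a metric space with the path metric in which each edge has length one; it need not be locally finite. A path is a continuous map from a compact interval. A (not necessarily continuous) map $q\colon X\to Y$ of metric spaces is a $(K,C)$-quasi-isometry if $d(x_1,x_2)/K-C\le d(q(x_1),q(x_2))\le Kd(x_1,x_2)+C$ for all $x_1,x_2\in X$ and every $y\in Y$ is at distance at most $C$ from some point of $q(X)$. Two metric spaces are quasi-isometric if there is a $(K,C)$-quasi-isometry between them for some $K\ge 1$, $C\ge 0$. *)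

(* Defs.v *)
From HB Require Import structures.
From mathcomp Require Import all_boot all_order all_algebra.
From mathcomp Require Import all_classical all_reals all_analysis.
From mathcomp Require Import lra.
Set Implicit Arguments.
Unset Strict Implicit.
Unset Printing Implicit Defensive.
Import Order.TTheory GRing.Theory Num.Theory.
Import numFieldNormedType.Exports.
Local Open Scope classical_set_scope.
Local Open Scope ring_scope.

(* No cardinality condition on the vertices and no local finiteness; the empty
   tree is allowed, since it is the only one quasi-isometric to an empty
   metric space. *)
Record simplicialTree := SimplicialTree {
  vertex : eqType ;
  adj : rel vertex ;
  adj_sym : symmetric adj ;
  adj_irrefl : irreflexive adj ;
  tree_connected : forall u v : vertex,
    exists2 p : seq vertex, path adj u p & v = last u p ;
  tree_acyclic : forall c : seq vertex, ucycle adj c -> (size c <= 2)%N }.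

(* The simplices are listed by their vertices: [:: u] is the vertex u,
   [:: u; v] with u and v adjacent is the closed edge from u to v. *)
Definition simplex (G : simplicialTree) (s : seq (vertex G)) : bool :=
  match s with
  | [:: _] => true
  | [:: u; v] => adj u v
  | _ => false
  end.

(* b is the barycentric coordinate function of a point of the closed
   simplex s. *)
Definition bary_on (R : realType) (G : simplicialTree) (s : seq (vertex G))
    (b : vertex G -> R) : Prop :=
  [/\ simplex s, forall w, 0 <= b w, forall w, w \notin s -> b w = 0
    & \sum_(w <- s) b w = 1].

(* The geometric realization of G: its points are given by their barycentric
   coordinates. *)
Record realization (R : realType) (G : simplicialTree) := Realization {
  bary : vertex G -> R ;
  bary_ex : exists s, bary_on s bary }.

HB.instance Definition _ (R : realType) (G : simplicialTree) :=
  gen_eqMixin (realization R G).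
HB.instance Definition _ (R : realType) (G : simplicialTree) :=
  gen_choiceMixin (realization R G).

(* On the edge [:: u; v], the points (1 - t) u + t v and (1 - t') u + t' v are
   at distance 1/2 (|t - t'| + |t - t'|) = |t - t'|: edges have length one. *)
Definition simplex_dist (R : realType) (G : simplicialTree)
    (s : seq (vertex G)) (x y : realization R G) : R :=
  2^-1 * \sum_(w <- s) `|bary x w - bary y w|.

(* pl_path x y l: some piecewise linear path from x to y, each piece of which
   is a segment of a closed simplex, has length l. *)
Inductive pl_path (R : realType) (G : simplicialTree) :
    realization R G -> realization R G -> R -> Prop :=
| pl_path_nil x : pl_path x x 0
| pl_path_cons s x y z l :
    bary_on s (bary x) -> bary_on s (bary y) -> pl_path y z l ->
    pl_path x z (simplex_dist s x y + l).

Definition path_dist (R : realType) (G : simplicialTree)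
    (x y : realization R G) : R := inf [set l | pl_path x y l].

Lemma bary_inj (R : realType) (G : simplicialTree) (x y : realization R G) :
  bary x =1 bary y -> x = y.
Proof.
case: x y => [b hb] [c hc] /= /funext bc; case: _ / bc hc => hc.
by congr Realization; exact: Prop_irrelevance.
Qed.

Lemma simplex_uniq (G : simplicialTree) (s : seq (vertex G)) :
  simplex s -> uniq s.
Proof.
case: s => [//|u [|v [|]]]//= uv; rewrite inE andbT.
by apply: contraTN uv => /eqP ->; rewrite adj_irrefl.
Qed.

Lemma simplex_dist_ge0 (R : realType) (G : simplicialTree)
    (s : seq (vertex G)) (x y : realization R G) : 0 <= simplex_dist s x y.
Proof. by rewrite mulr_ge0 ?invr_ge0// sumr_ge0. Qed.

Lemma simplex_dist_sym (R : realType) (G : simplicialTree)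
    (s : seq (vertex G)) (x y : realization R G) :
  simplex_dist s x y = simplex_dist s y x.
Proof. by congr (_ * _); apply: eq_bigr => w _; rewrite distrC. Qed.

Lemma simplex_dist_ge (R : realType) (G : simplicialTree)
    (s : seq (vertex G)) (x y : realization R G) (w : vertex G) :
  bary_on s (bary x) -> bary_on s (bary y) ->
  `|bary x w - bary y w| <= simplex_dist s x y.
Proof.
move=> xs ys; have [ws|ws] := boolP (w \in s); last first.
  case: xs => _ _ -> // _; case: ys => _ _ -> // _.
  by rewrite subrr normr0 simplex_dist_ge0.
rewrite /simplex_dist; case: s xs ys ws => [[]//|u [|v [|? ?]]] [//hs _ _ +].
- rewrite !big_seq1 => xu [_ _ _]; rewrite !big_seq1 => yu.
  by rewrite inE => /eqP ->; rewrite xu yu subrr normr0 mulr0.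
- rewrite !big_cons !big_nil !addr0 => xu [_ _ _].
  rewrite !big_cons !big_nil !addr0 => yu.
  have E : bary x v - bary y v = - (bary x u - bary y u) by lra.
  rewrite !inE => /orP[] /eqP ->; rewrite E !normrN; lra.
Qed.

Lemma pl_path_ge0 (R : realType) (G : simplicialTree)
    (x y : realization R G) (l : R) : pl_path x y l -> 0 <= l.
Proof.
by elim=> // s a b c k _ _ _ k0; rewrite addr_ge0 ?simplex_dist_ge0.
Qed.

Lemma pl_path_ge (R : realType) (G : simplicialTree)
    (x y : realization R G) (l : R) (w : vertex G) :
  pl_path x y l -> `|bary x w - bary y w| <= l.
Proof.
elim=> [a|s a b c k sa sb _ bc]; first by rewrite subrr normr0.
by rewrite (le_trans (ler_distD (bary b w) _ _))// lerD// simplex_dist_ge.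
Qed.

Lemma pl_path_cat (R : realType) (G : simplicialTree)
    (x y z : realization R G) (k l : R) :
  pl_path x y k -> pl_path y z l -> pl_path x z (k + l).
Proof.
elim=> [a|s a b c j sa sb _ IH /IH bz]; first by rewrite add0r.
by rewrite -addrA; exact: (pl_path_cons sa sb).
Qed.

Lemma pl_path1 (R : realType) (G : simplicialTree) (s : seq (vertex G))
    (x y : realization R G) :
  bary_on s (bary x) -> bary_on s (bary y) -> pl_path x y (simplex_dist s x y).
Proof.
move=> sx sy; rewrite -[simplex_dist _ _ _]addr0.
exact: (pl_path_cons sx sy (pl_path_nil y)).
Qed.

Lemma pl_path_sym (R : realType) (G : simplicialTree)
    (x y : realization R G) (l : R) : pl_path x y l -> pl_path y x l.
Proof.
elim=> [a|s a b c k sa sb _ cb]; first exact: pl_path_nil.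
by rewrite addrC simplex_dist_sym; apply: (pl_path_cat cb); exact: pl_path1.
Qed.

Lemma bary_on_vertex (R : realType) (G : simplicialTree) (s : seq (vertex G))
    (u : vertex G) :
  simplex s -> u \in s -> bary_on s (fun w => (w == u)%:R : R).
Proof.
move=> hs us; split=> // [w|]; first by case: eqP => // ->; rewrite us.
rewrite (bigD1_seq u) ?simplex_uniq//= eqxx big1 ?addr0// => w /negbTE -> //.
Qed.

Lemma vertex_bary_ex (R : realType) (G : simplicialTree) (u : vertex G) :
  exists s, bary_on s (fun w => (w == u)%:R : R).
Proof. by exists [:: u]; apply: bary_on_vertex; rewrite ?inE. Qed.

Definition vertex_point (R : realType) (G : simplicialTree) (u : vertex G) :
  realization R G := Realization (vertex_bary_ex R u).

Lemma pl_path_ex (R : realType) (G : simplicialTree) (x y : realization R G) :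
  exists l, pl_path x y l.
Proof.
have near_vertex (z : realization R G) :
    exists u l, pl_path z (vertex_point R u) l.
  have [s zs] := bary_ex z; have [hs _ _ _] := zs.
  have [u us] : exists u, u \in s.
    by case: s hs {zs} => // u s _; exists u; rewrite inE eqxx.
  by exists u, (simplex_dist s z (vertex_point R u)); apply: pl_path1 => //;
    exact: bary_on_vertex.
have [u [k xu]] := near_vertex x; have [v [l yv]] := near_vertex y.
have [j uv] : exists j, pl_path (vertex_point R u) (vertex_point R v) j.
  have [p + ->] := tree_connected u v; elim: p u {xu} => [u _|w p IH u] /=.
    by exists 0; exact: pl_path_nil.
  move=> /andP[uw /IH[j wj]].
  exists (simplex_dist [:: u; w] (vertex_point R u) (vertex_point R w) + j).
  by apply: (pl_path_cons _ _ wj); apply: bary_on_vertex;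
    rewrite // !inE eqxx ?orbT.
exists (k + (j + l)); apply: (pl_path_cat xu); apply: (pl_path_cat uv).
exact: pl_path_sym.
Qed.

Lemma pl_path_has_inf (R : realType) (G : simplicialTree)
    (x y : realization R G) : has_inf [set l | pl_path x y l].
Proof.
split; first exact: pl_path_ex.
by exists 0 => l /=; exact: pl_path_ge0.
Qed.

Lemma path_distxx (R : realType) (G : simplicialTree) (x : realization R G) :
  path_dist x x = 0.
Proof.
apply/eqP; rewrite eq_le; apply/andP; split.
  by apply: ge_inf; [have [] := pl_path_has_inf x x|exact: pl_path_nil].
apply: lb_le_inf; first exact: pl_path_ex.
by move=> l /=; exact: pl_path_ge0.
Qed.

Lemma path_dist_positivity (R : realType) (G : simplicialTree)
    (x y : realization R G) : path_dist x y = 0 -> x = y.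
Proof.
move=> d0; apply: bary_inj => w.
apply/eqP; rewrite -subr_eq0 -normr_le0 -d0.
apply: lb_le_inf; first exact: pl_path_ex.
by move=> l /=; exact: pl_path_ge.
Qed.

Lemma path_dist_sym (R : realType) (G : simplicialTree)
    (x y : realization R G) : path_dist x y = path_dist y x.
Proof.
by congr inf; apply/seteqP; split=> l /=; exact: pl_path_sym.
Qed.

Lemma path_dist_triangle (R : realType) (G : simplicialTree)
    (y x z : realization R G) :
  path_dist x z <= path_dist x y + path_dist y z.
Proof.
rewrite -lerBlDr; apply: lb_le_inf; first exact: pl_path_ex.
move=> k /= xy; rewrite lerBlDr addrC -lerBlDr.
apply: lb_le_inf; first exact: pl_path_ex.
move=> l /= yz; rewrite lerBlDr addrC.
apply: ge_inf; first by have [] := pl_path_has_inf x z.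
exact: (pl_path_cat xy yz).
Qed.

HB.instance Definition _ (R : realType) (G : simplicialTree) :=
  @isMetric.Build R (realization R G) (@path_dist R G) (@path_distxx R G)
    (@path_dist_positivity R G) (@path_dist_sym R G) (@path_dist_triangle R G).

Definition quasi_isometry (R : realType) (X Y : metricType R) (K C : R)
    (q : X -> Y) : Prop :=
  (forall x1 x2 : X,
     mdist x1 x2 / K - C <= mdist (q x1) (q x2) <= K * mdist x1 x2 + C) /\
  (forall y : Y, exists x : X, mdist y (q x) <= C).

Definition quasi_isometric (R : realType) (X Y : metricType R) : Prop :=
  exists K C : R, [/\ 1 <= K, 0 <= C &
    exists q : X -> Y, quasi_isometry K C q].

Definition geodesic_space (R : realType) (Y : metricType R) : Prop :=
  forall x y : Y, exists g : R -> Y,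
    [/\ g 0 = x, g (mdist x y) = y &
      {in `[0, mdist x y] &, forall s t : R, mdist (g s) (g t) = `|s - t|}].

Definition is_path (R : realType) (Y : metricType R) (x y : Y) (a b : R)
    (g : R -> Y) : Prop :=
  [/\ a <= b, {within `[a, b], continuous g}, g a = x & g b = y].

Definition bottleneck_property (R : realType) (Y : metricType R) : Prop :=
  exists2 Delta : R, 0 < Delta &
    forall x y : Y, exists m : Y,
      [/\ mdist x m = mdist x y / 2, mdist y m = mdist x y / 2 &
        forall (a b : R) (g : R -> Y), is_path x y a b g ->
          exists2 t : R, t \in `[a, b] & mdist (g t) m < Delta].

(* Main.v *)
Require Import Defs.
From mathcomp Require Import all_boot all_order all_algebra.
From mathcomp Require Import all_classical all_reals all_analysis.
From mathcomp Require Import lra.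
Set Implicit Arguments.
Unset Strict Implicit.
Unset Printing Implicit Defensive.
Import Order.TTheory GRing.Theory Num.Theory.
Import numFieldNormedType.Exports.
Local Open Scope classical_set_scope.
Local Open Scope ring_scope.

(** A tree has the following separation property: three vertices u, v, w have a
    median z, which every walk between two of them must visit [tree_median].
    Let q be a quasi-isometry from Y to a tree, g a geodesic from x to y with
    midpoint m, and z a median for vertices near q(x), q(y) and q(m). The image
    under q of a path in Y makes only small jumps, so it cannot change sides of
    z without coming near z [path_meets_separator]. This holds for any path h
    from x to y, and also for the two halves of g, one before and one after m.
    So some h(t), some g(t1) before m and some g(t2) after m have images near z,
    hence are near each other in Y; since m lies on g between g(t1) and g(t2),
    it is near h(t).

    Conversely, assume the Bottleneck Property and fix a point p of Y. First,
    the property passes from midpoints to all points of geodesics: a point of a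
    geodesic that is not near an end point is the midpoint of a subsegment, and
    a path from x to y can be completed to a path joining the ends of that
    subsegment by a piece of the geodesic that stays away from its midpoint
    [geodesic_bottleneck]. Second, every path from x to y comes as close to p as
    the Gromov product (x|y)_p = (d(p,x) + d(p,y) - d(x,y)) / 2 allows, up to a
    constant [path_gromov_product]: it passes near the point z of a geodesic
    from x to y at distance (p|y)_x from x, and z is near the union of geodesics
    from p to x and to y, which forces d(p,z) to be about (x|y)_p.

    The tree has as vertices the pairs of an integer n and a path component of
    {y | n <= d(p,y)} that meets {y | d(p,y) < n+1}; the parent of a component
    of level n+1 is the component of level n that contains it. As parents are
    unique and one level lower, and level 0 consists of one vertex, this is a
    tree [child_tree]. The quasi-isometry q sends x to the component of x at the
    level floor(d(p,x)).
    - Lower bound: two points at height about n in one component of level n are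
      joined by a path at distance at least n from p, so they are at bounded
      distance by the estimate on Gromov products. If each vertex v is given a
      representative rep(v), then v |-> d(x, rep(v)) changes by at most a
      constant L along each edge, hence is L-Lipschitz on the tree
      [vertex_point_lipschitz]; compare its values at q(x) and q(y).
    - Upper bound: a geodesic from x to y stays at distance at least
      d(p,x) - d(x,y) from p, so q(x) and q(y) have a common ancestor at about
      this level; the branches down to it have total length about
      d(p,x) + d(p,y) - 2 (d(p,x) - d(x,y)) <= 3 d(x,y). *)

(** * Paths in a metric space *)

Lemma within_itv_continuousP (R : realType) (Y : metricType R) (a b : R)
    (g : R -> Y) :
  {within `[a, b], continuous g} <->
  (forall t, t \in `[a, b] -> forall e, 0 < e -> exists2 d, 0 < d &
     forall s, s \in `[a, b] -> `|t - s| < d -> mdist (g t) (g s) < e).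
Proof.
rewrite subspace_continuousP; split=> cg t tab.
  move=> e e0; have /metricType_numDomainType.cvgrPdist_lt/(_ e e0) := cg t tab.
  rewrite near_withinE => /nbhs_ballP[d /= d0 H].
  by exists d => // s sab ts; exact: H.
apply/metricType_numDomainType.cvgrPdist_lt => e e0.
have [d d0 H] := cg t tab e e0.
rewrite near_withinE; apply/nbhs_ballP; exists d => //= s ts sab.
exact: H.
Qed.

(** Connectedness of an interval in the form of an induction principle: the
    points related to the end a form a clopen subset. *)
Lemma itv_locally_constant_rel (R : realType) (a b : R) (E : R -> R -> Prop) :
  a <= b -> E a a -> (forall s t u, E s t -> E t u -> E s u) ->
  (forall t, t \in `[a, b] -> exists2 d : R, 0 < d &
     forall s, s \in `[a, b] -> `|t - s| < d -> E t s /\ E s t) ->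
  E a b.
Proof.
move=> ab Eaa tr loc.
have [aa bb] : a \in `[a, b] /\ b \in `[a, b] by rewrite !in_itv/= !lexx ab.
pose B := [set t | t \in `[a, b] /\ E a t].
suff : B = `[a, b]%classic by move/seteqP => [_ /(_ b bb) []].
apply: (@segment_connected R a b); first by exists a.
- exists [set t | t \in `[a, b] -> E a t]^°; first exact: open_interior.
  apply/seteqP; split=> t [tab].
    move=> Eat; split => //; have [d d0 H] := loc t tab.
    by apply/nbhs_ballP; exists d => //= s ts /H[]// Ets _; exact: tr Ets.
  by move/interior_subset => H; split => //; exact: H.
- exists (~` [set t | t \in `[a, b] -> ~ E a t]^°).
    by apply: open_closedC; exact: open_interior.
  apply/seteqP; split=> t [tab].
    by move=> Eat; split => // /interior_subset /(_ tab).
  move=> H; split => //; apply: contrapT => nE; apply: H.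
  have [d d0 H] := loc t tab.
  apply/nbhs_ballP; exists d => //= s ts /H[]// _ Est Eas.
  by apply: nE; exact: tr Est.
Qed.

(** The predicate P carries along the locus of a path, so that the
    parametrization of the concatenation never has to be inspected. *)
Lemma is_path_trans (R : realType) (Y : metricType R) (x y z : Y)
    (a b a' b' : R) (g h : R -> Y) (P : set Y) :
  is_path x y a b g -> (forall t, t \in `[a, b] -> P (g t)) ->
  is_path y z a' b' h -> (forall t, t \in `[a', b'] -> P (h t)) ->
  exists c d k, is_path x z c d k /\ forall t, t \in `[c, d] -> P (k t).
Proof.
move=> [ab cg gx gy] Pg [ab' ch hy hz] Ph.
pose k t := if t <= b then g t else h (t - b + a').
have kh t : b <= t -> k t = h (t - b + a').
  rewrite le_eqVlt => /predU1P[<-|bt]; last by rewrite /k leNgt bt.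
  by rewrite /k lexx subrr add0r gy hy.
exists a, (b + (b' - a')), k; split; last first.
  move=> t; rewrite in_itv/= => /andP[at_ tb].
  have [tb'|bt] := leP t b.
    by rewrite /k tb'; apply: Pg; rewrite in_itv/= at_.
  rewrite kh ?ltW//; apply: Ph; rewrite in_itv/=; apply/andP; split; lra.
split.
- lra.
- have -> : `[a, b + (b' - a')]%classic = `[a, b] `|` `[b, b + (b' - a')].
    apply/seteqP; split=> t /=; rewrite !in_itv/=.
      move=> /andP[at_ tb']; have [tb|/ltW bt] := leP t b.
        by left; rewrite at_.
      by right; rewrite bt.
    by case=> /andP[? ?]; apply/andP; split; lra.
  apply: withinU_continuous; [exact: itv_closed|exact: itv_closed| |].
    apply/within_itv_continuousP => t tab e e0.
    have /within_itv_continuousP/(_ t tab e e0)[d d0 H] := cg.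
    exists d => // s sab ts; move: (tab) (sab); rewrite !in_itv/=.
    by move=> /andP[_ tb] /andP[_ sb]; rewrite /k tb sb; exact: H.
  apply/within_itv_continuousP => t + e e0; rewrite in_itv/= => /andP[bt tb].
  have tab : t - b + a' \in `[a', b'].
    by rewrite in_itv/=; apply/andP; split; lra.
  have /within_itv_continuousP/(_ _ tab e e0)[d d0 H] := ch.
  exists d => // s; rewrite in_itv/= => /andP[bs sb] ts.
  rewrite !kh//; apply: H.
    by rewrite in_itv/=; apply/andP; split; lra.
  by rewrite (_ : _ - _ = t - s)//; lra.
- by rewrite /k ab.
- rewrite kh; last lra.
  by rewrite (_ : _ - _ + _ = b') ?hz//; lra.
Qed.

Lemma is_path_sym (R : realType) (Y : metricType R) (x y : Y) (a b : R)
    (g : R -> Y) :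
  is_path x y a b g -> is_path y x (- b) (- a) (fun t => g (- t)).
Proof.
move=> [ab cg gx gy]; split; rewrite ?opprK ?lerN2//.
apply/within_itv_continuousP => t; rewrite in_itv/= => /andP[bt ta] e e0.
have tab : - t \in `[a, b] by rewrite in_itv/=; apply/andP; split; lra.
have /within_itv_continuousP/(_ _ tab e e0)[d d0 H] := cg.
exists d => // s; rewrite in_itv/= => /andP[bs sa] ts.
apply: H; first by rewrite in_itv/=; apply/andP; split; lra.
by rewrite (_ : _ - _ = - (t - s)) ?normrN//; lra.
Qed.

Definition geodesic (R : realType) (Y : metricType R) (x y : Y) (g : R -> Y) :=
  [/\ g 0 = x, g (mdist x y) = y &
      {in `[0, mdist x y] &, forall s t : R, mdist (g s) (g t) = `|s - t|}].

Lemma geodesic_mdistl (R : realType) (Y : metricType R) (x y : Y) (g : R -> Y)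
    (t : R) : geodesic x y g -> t \in `[0, mdist x y] -> mdist x (g t) = t.
Proof.
move=> [g0 g1 gi] td; rewrite -{1}g0 gi//.
  by move: td; rewrite in_itv/= sub0r normrN => /andP[/ger0_norm ->].
by rewrite in_itv/= lexx mdist_ge0.
Qed.

Lemma geodesic_mdistr (R : realType) (Y : metricType R) (x y : Y) (g : R -> Y)
    (t : R) : geodesic x y g -> t \in `[0, mdist x y] ->
  mdist (g t) y = mdist x y - t.
Proof.
move=> [g0 g1 gi] td; rewrite -{1}g1 gi//.
  move: td; rewrite in_itv/= distrC => /andP[? ?].
  by rewrite ger0_norm// subr_ge0.
by rewrite in_itv/= lexx mdist_ge0.
Qed.

Lemma geodesic_is_path (R : realType) (Y : metricType R) (x y : Y) (g : R -> Y)
    (s t : R) : geodesic x y g -> 0 <= s -> s <= t -> t <= mdist x y ->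
  is_path (g s) (g t) s t g.
Proof.
move=> [g0 g1 gi] s0 st td; split=> //.
apply/within_itv_continuousP => u; rewrite in_itv/= => /andP[su ut] e e0.
exists e => // v; rewrite in_itv/= => /andP[sv vt] uv.
by rewrite gi// in_itv/=; apply/andP; split; lra.
Qed.

(** * Separation in trees *)

Lemma walk_rev (T : eqType) (e : rel T) (u v : T) (p : seq T) :
  symmetric e -> path e u p -> last u p = v ->
  exists q, [/\ path e v q, last v q = u & v :: q = rev (u :: p)].
Proof.
move=> esym up <-; exists (rev (belast u p)); split.
- by rewrite rev_path (eq_path (e' := e))// => x y; rewrite esym.
- by case: (p) => //= x s; rewrite rev_cons last_rcons.
- by rewrite [in RHS]lastI rev_rcons.
Qed.

(** At the first vertex u where two simple paths with the same ends part, the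
    rest of the one and the reverse of the other join the two neighbours of u
    without visiting u; shortened, this closes up to a simple cycle
    through u. *)
Lemma tree_path_uniq (G : simplicialTree) (u : vertex G)
    (p p' : seq (vertex G)) :
  path (@adj G) u p -> path (@adj G) u p' -> uniq (u :: p) -> uniq (u :: p') ->
  last u p = last u p' -> p = p'.
Proof.
elim: p u p' => [|w p IH] u [|w' p'] //=.
- by move=> _ _ _ /andP[+ _] up'; rewrite {1}up' mem_last.
- by move=> _ _ /andP[+ _] _ up'; rewrite -{1}up' mem_last.
move=> /andP[uw wp] /andP[uw' wp'] /andP[up uniqp] /andP[up' uniqp'] pp'.
have [ww'|ww'] := eqVneq w w'.
  by subst w'; congr cons; exact: IH wp' _ _ pp'.
have [r [wr lr Er]] := walk_rev (@adj_sym G) wp' (esym pp').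
(* the two paths, run through from w to w', bypass u *)
pose q := p ++ r.
have wq : path (@adj G) w q by rewrite cat_path wp.
have lq : last w q = w' by rewrite last_cat.
have uq : u \notin w :: q.
  rewrite -cat_cons mem_cat negb_or up; apply: contra up' => ur.
  by rewrite -mem_rev -Er inE ur orbT.
case/shortenP: wq lq => q' wq' uniqq' sub lq'.
have /tree_acyclic : ucycle (@adj G) [:: u, w & q'].
  apply/andP; split=> /=; first by rewrite uw rcons_path wq' lq' adj_sym uw'.
  rewrite -/(uniq (w :: q')) uniqq' andbT.
  apply: contra uq; rewrite !inE => /predU1P[->|/sub ->]; rewrite ?eqxx ?orbT//.
by case: (q') lq' => //= /eqP; rewrite (negbTE ww').
Qed.

Definition separates (G : simplicialTree) (z u v : vertex G) : Prop :=
  forall p, path (@adj G) u p -> last u p = v -> z \in u :: p.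

Lemma separates_simple_path (G : simplicialTree) (z u : vertex G)
    (p : seq (vertex G)) :
  path (@adj G) u p -> uniq (u :: p) -> z \in u :: p ->
  separates z u (last u p).
Proof.
move=> up uniqp zp q uq; case/shortenP: uq => q' uq' uniqq' sub lq.
rewrite -(tree_path_uniq uq' up uniqq' uniqp lq) in zp.
by move: zp; rewrite !inE => /predU1P[->|/sub ->]; rewrite ?eqxx ?orbT.
Qed.

Lemma separates_sym (G : simplicialTree) (z u v : vertex G) :
  separates z u v -> separates z v u.
Proof.
move=> zuv p vp lp; have [q [uq lq Eq]] := walk_rev (@adj_sym G) vp lp.
by have := zuv q uq lq; rewrite Eq mem_rev.
Qed.

(** The arc of the simple path u :: p up to z, followed by a simple path that
    branches off at z, is again simple. *)
Lemma separates_branch (G : simplicialTree) (z u : vertex G)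
    (p r : seq (vertex G)) :
  path (@adj G) u p -> uniq (u :: p) -> z \in u :: p ->
  path (@adj G) z r -> uniq (z :: r) -> {in r, forall x, x \notin u :: p} ->
  separates z u (last z r).
Proof.
move=> up uniqp zp zr uniqr rp.
case/splitPl: zp up uniqp rp => p1 p2 lp1.
rewrite cat_path -cat_cons cat_uniq => /andP[up1 _] /andP[uniqp1 _] rp.
rewrite -lp1 -last_cat; apply: separates_simple_path.
- by rewrite cat_path up1 lp1.
- rewrite -cat_cons cat_uniq uniqp1; move: uniqr => /= /andP[_ ->].
  rewrite andbT; apply/hasPn => x /rp.
  by rewrite mem_cat negb_or => /andP[].
- by rewrite -cat_cons mem_cat mem_last.
Qed.

Lemma tree_simple_path (G : simplicialTree) (u v : vertex G) :
  exists p, [/\ path (@adj G) u p, uniq (u :: p) & last u p = v].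
Proof.
have [p up ->] := tree_connected u v.
by case/shortenP: up => q uq uniqq _; exists q.
Qed.

(** z is the point where the simple path from w to u first meets the simple
    path from u to v. *)
Lemma tree_median (G : simplicialTree) (u v w : vertex G) :
  exists z, [/\ separates z u v, separates z u w & separates z v w].
Proof.
have [p [up uniqp lp]] := tree_simple_path u v.
have [q [wq uniqq lq]] := tree_simple_path w u.
have hasP' : has [in u :: p] (w :: q).
  by apply/hasP; exists u; [rewrite -lq mem_last|exact: mem_head].
have [z [s1 [s2 [E zp s1p]]]] : exists z s1 s2,
    [/\ w :: q = rcons s1 z ++ s2, z \in u :: p & ~~ has [in u :: p] s1].
  by case/split_find: hasP' => z s1 s2 zp s1p; exists z, s1, s2.
have zs1 : path (@adj G) z (rev s1).
  have /cat_sorted2[+ _] : sorted (@adj G) (rcons s1 z ++ s2) by rewrite -E.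
  rewrite -[path _ _ _]/(sorted (@adj G) (z :: rev s1)) -rev_rcons rev_sorted.
  by rewrite (eq_sorted (e' := @adj G))// => x y; rewrite adj_sym.
have uniqs1 : uniq (z :: rev s1).
  rewrite -rev_rcons rev_uniq.
  by move: uniqq; rewrite E cat_uniq => /andP[].
have lw : last z (rev s1) = w.
  by case: (s1) E => [|x s] [-> _]//; rewrite rev_cons last_rcons.
have s1P : {in rev s1, forall x, x \notin u :: p}.
  by move=> x; rewrite mem_rev => xs; exact: (hasPn s1p).
exists z; split.
- by rewrite -lp; exact: separates_simple_path.
- by rewrite -lw; exact: separates_branch up uniqp zp zs1 uniqs1 s1P.
- have [r [vr _ Er]] := walk_rev (@adj_sym G) up lp.
  rewrite -lw; apply: (separates_branch vr) => //.
  + by rewrite Er rev_uniq.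
  + by rewrite Er mem_rev.
  + by move=> x /s1P; rewrite Er mem_rev.
Qed.

(** The connected components of the tree with the vertex z removed. *)
Definition joined_off (G : simplicialTree) (z u v : vertex G) : Prop :=
  exists p, [/\ path (@adj G) u p, last u p = v & z \notin u :: p].

Lemma joined_off_trans (G : simplicialTree) (z u v w : vertex G) :
  joined_off z u v -> joined_off z v w -> joined_off z u w.
Proof.
move=> [p [up lp zp]] [q [vq lq zq]]; exists (p ++ q); split.
- by rewrite cat_path up lp.
- by rewrite last_cat lp.
- rewrite -cat_cons mem_cat negb_or zp; apply: contra zq.
  by rewrite inE orbC => ->.
Qed.

Lemma joined_off_sym (G : simplicialTree) (z u v : vertex G) :
  joined_off z u v -> joined_off z v u.
Proof.
move=> [p [up lp zp]]; have [q [vq lq Eq]] := walk_rev (@adj_sym G) up lp.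
by exists q; split; rewrite // Eq mem_rev.
Qed.

(** * Vertices near a point of the geometric realization *)

(** The vertices of the simplices that contain x. As x may lie in several listed
    simplices, this is a relation and no vertex is singled out. *)
Definition carried (R : realType) (G : simplicialTree) (x : realization R G)
    (u : vertex G) : Prop := exists2 s, bary_on s (bary x) & u \in s.

Lemma carried_ex (R : realType) (G : simplicialTree) (x : realization R G) :
  exists u, carried x u.
Proof.
have [s xs] := bary_ex x; have [hs _ _ _] := xs.
by case: s hs xs => // u s _ xs; exists u, (u :: s); rewrite ?inE ?eqxx.
Qed.

Lemma simplex_dist_le1 (R : realType) (G : simplicialTree) (s : seq (vertex G))
    (x y : realization R G) :
  bary_on s (bary x) -> bary_on s (bary y) -> simplex_dist s x y <= 1.
Proof.
move=> [_ x0 _ x1] [_ y0 _ y1].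
suff : \sum_(w <- s) `|bary x w - bary y w| <= 2 by rewrite /simplex_dist; lra.
rewrite (_ : 2 = 1 + 1)// -{1}x1 -y1 -big_split/=; apply: ler_sum => w _.
by rewrite (le_trans (ler_normB _ _))// !ger0_norm.
Qed.

Lemma mdist_le_pl_path (R : realType) (G : simplicialTree)
    (x y : realization R G) (l : R) : pl_path x y l -> mdist x y <= l.
Proof. by apply: ge_inf; have [] := pl_path_has_inf x y. Qed.

Lemma carried_mdist_le1 (R : realType) (G : simplicialTree)
    (x : realization R G) (u : vertex G) :
  carried x u -> mdist x (vertex_point R u) <= 1.
Proof.
move=> [s xs us]; have [hs _ _ _] := xs.
have vs : bary_on s (bary (vertex_point R u)) by exact: bary_on_vertex.
exact: le_trans (mdist_le_pl_path (pl_path1 xs vs)) (simplex_dist_le1 xs vs).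
Qed.

Lemma simplex_walk (G : simplicialTree) (s : seq (vertex G)) (u v : vertex G) :
  simplex s -> u \in s -> v \in s ->
  exists p, [/\ path (@adj G) u p, last u p = v & {subset u :: p <= s}].
Proof.
move=> hs us vs; have [<-|uv] := eqVneq u v.
  by exists [::]; split=> // x; rewrite inE => /eqP ->.
exists [:: v]; split=> //=; last first.
  by move=> x; rewrite !inE => /orP[] /eqP ->.
case: s hs us vs => [|a [|b []]]//=; rewrite !inE.
  by move=> _ /eqP ua /eqP va; rewrite ua va eqxx in uv.
move=> ab /orP[] /eqP ua /orP[] /eqP va; subst u v; rewrite ?andbT//.
- by rewrite eqxx in uv.
- by rewrite adj_sym.
- by rewrite eqxx in uv.
Qed.

(** Two simplices that contain x share any vertex at which the barycentric
    coordinate of x does not vanish. *)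
Lemma carried_walk (R : realType) (G : simplicialTree) (x : realization R G)
    (u v : vertex G) :
  carried x u -> carried x v ->
  exists p, [/\ path (@adj G) u p, last u p = v &
                {in u :: p, forall w, carried x w}].
Proof.
move=> [s xs us] [s' xs' vs'].
have [hs _ x0 x1] := xs; have [hs' _ x0' _] := xs'.
have [w xw] : exists w, bary x w != 0.
  apply: contrapT => /forallNP H; have /eqP := oner_neq0 R; apply.
  by rewrite -x1; apply: big1 => w _; apply/eqP/negPn/negP/H.
have ws : w \in s by apply: contraNT xw => /x0 ->.
have ws' : w \in s' by apply: contraNT xw => /x0' ->.
have [p [up lp ps]] := simplex_walk hs us ws.
have [q [wq lq qs]] := simplex_walk hs' ws' vs'.
exists (p ++ q); split; [by rewrite cat_path up lp|by rewrite last_cat lp|].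
move=> y; rewrite -cat_cons mem_cat => /orP[/ps ys|yq]; first by exists s.
by exists s' => //; apply: qs; rewrite inE yq orbT.
Qed.

(** A walk follows the piecewise linear path: one vertex is chosen in the
    simplex of each piece, and consecutive choices both carry the break point
    between their pieces. *)
Lemma pl_path_walk (R : realType) (G : simplicialTree) (x y : realization R G)
    (l : R) (u v : vertex G) :
  pl_path x y l -> carried x u -> carried y v ->
  exists p, [/\ path (@adj G) u p, last u p = v &
                {in u :: p, forall w, mdist x (vertex_point R w) <= l + 1}].
Proof.
move=> xy; elim: xy u v => [a|s a b c k sa sb bc IH] u v.
  move=> au av; have [p [up lp pa]] := carried_walk au av.
  by exists p; split=> // w /pa; rewrite add0r; exact: carried_mdist_le1.
move=> au cv; have [w ws] : exists w, w \in s.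
  by case: sa => + _ _ _; case: (s) => // w t _; exists w; exact: mem_head.
have [p [up lp pa]] : exists p, [/\ path (@adj G) u p, last u p = w &
    {in u :: p, forall w, carried a w}] by apply: carried_walk => //; exists s.
have [q [wq lq qb]] := IH w v (ex_intro2 _ _ s sb ws) cv.
exists (p ++ q); split; [by rewrite cat_path up lp|by rewrite last_cat lp|].
have k0 := pl_path_ge0 bc; have d0 := simplex_dist_ge0 s a b.
move=> z; rewrite -cat_cons mem_cat => /orP[/pa|zq].
  by move/carried_mdist_le1; lra.
have ab := mdist_le_pl_path (pl_path1 sa sb).
have bz : mdist b (vertex_point R z) <= k + 1 by apply: qb; rewrite inE zq orbT.
by have := metric_triangle a b (vertex_point R z); lra.
Qed.

Lemma mdist_lt_walk (R : realType) (G : simplicialTree) (x y : realization R G)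
    (l : R) (u v : vertex G) :
  mdist x y < l -> carried x u -> carried y v ->
  exists p, [/\ path (@adj G) u p, last u p = v &
                {in u :: p, forall w, mdist x (vertex_point R w) <= l + 1}].
Proof.
move=> xyl xu yv.
have [k xyk kl] := inf_lt (pl_path_ex x y) xyl.
have [p [up lp H]] := pl_path_walk xyk xu yv.
by exists p; split=> // w /H; lra.
Qed.

(** If the image of the path stayed far from z, then all vertices near q (g t),
    for t in [a, b], would lie in one component of the tree without z: nearby
    values of t give images at distance less than J, hence vertices joined by a
    walk that remains far from z. *)
Lemma path_meets_separator (R : realType) (Y : metricType R)
    (G : simplicialTree) (q : Y -> realization R G) (J : R) (x y : Y)
    (a b : R) (g : R -> Y) (z u v : vertex G) :
  (forall x1 x2, mdist x1 x2 < 1 -> mdist (q x1) (q x2) < J) ->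
  is_path x y a b g -> carried (q x) u -> carried (q y) v -> separates z u v ->
  exists2 t, t \in `[a, b] & mdist (q (g t)) (vertex_point R z) <= J + 1.
Proof.
move=> qJ [ab cg gx gy] xu yv zuv; apply: contrapT => /forall2NP far.
have {}far t : t \in `[a, b] -> J + 1 < mdist (q (g t)) (vertex_point R z).
  by move=> tab; rewrite ltNge; apply/negP; have [] := far t.
have J0 : 0 < J by rewrite -(mdistxx (q x)); apply: qJ; rewrite mdistxx.
have off t s w w' : t \in `[a, b] -> mdist (q (g t)) (q (g s)) < J ->
    carried (q (g t)) w -> carried (q (g s)) w' -> joined_off z w w'.
  move=> tab ts tw sw'; have [p [wp lp pt]] := mdist_lt_walk ts tw sw'.
  by exists p; split=> //; apply/negP => /pt; rewrite leNgt far.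
suff : forall w w', carried (q (g a)) w -> carried (q (g b)) w' ->
    joined_off z w w'.
  rewrite gx gy => /(_ u v xu yv)[p [up lp]].
  by apply/negP; rewrite negbK; exact: zuv.
have aab : a \in `[a, b] by rewrite in_itv/= lexx.
apply: (@itv_locally_constant_rel R a b (fun t s => forall w w',
    carried (q (g t)) w -> carried (q (g s)) w' -> joined_off z w w')) => //.
- by move=> w w'; apply: off; rewrite // mdistxx.
- move=> r s t rs st w w' rw tw'; have [w1 sw1] := carried_ex (q (g s)).
  exact: joined_off_trans (rs _ _ rw sw1) (st _ _ sw1 tw').
- move=> t tab.
  have /within_itv_continuousP/(_ t tab 1 ltr01)[d d0 H] := cg.
  exists d => // s sab ts; have Jts := qJ _ _ (H s sab ts).
  split=> w w' tw sw'; first exact: off Jts tw sw'.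
  by apply: joined_off_sym; exact: off Jts sw' tw.
Qed.

(** The median z of the vertices near q x, q y and q m is near the image of a
    point on each of three paths: the given path and the two halves of the
    geodesic, which surround m. *)
Lemma quasi_tree_bottleneck (R : realType) (Y : metricType R)
    (G : simplicialTree) :
  geodesic_space Y -> quasi_isometric Y (realization R G) ->
  bottleneck_property Y.
Proof.
move=> hY [K [C [K1 C0 [q [qKC _]]]]].
have K0 : 0 < K by rewrite (lt_le_trans _ K1).
pose J := K + C + 1.
have qJ x1 x2 : mdist x1 x2 < 1 -> mdist (q x1) (q x2) < J.
  move=> d1; have /andP[_ /le_lt_trans] := qKC x1 x2; apply.
  have : K * mdist x1 x2 <= K * 1 by rewrite ler_pM2l// ltW.
  rewrite /J; lra.
pose L := K * (2 * (J + 1) + C).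
have close x1 x2 z : mdist (q x1) z <= J + 1 -> mdist (q x2) z <= J + 1 ->
    mdist x1 x2 <= L.
  move=> x1z x2z; have /andP[H _] := qKC x1 x2.
  have := metric_triangle (q x1) z (q x2); rewrite (metric_sym z) => T.
  have {H}: mdist x1 x2 / K <= 2 * (J + 1) + C by lra.
  by rewrite ler_pdivrMr// mulrC.
have L0 : 0 <= L by rewrite mulr_ge0 ?ltW// /J; lra.
(* L for the distance from the path to g t1, L for that from g t1 to m *)
exists (2 * L + 1); first lra.
move=> x y; have [g gxy] := hY x y; have := mdist_ge0 x y.
set d := mdist x y in gxy *; move=> d0.
have in_d t : 0 <= t -> t <= d -> t \in `[0, d] by rewrite in_itv/= => -> ->.
have d2 : d / 2 \in `[0, d] by apply: in_d; lra.
have [g0 g1 gi] := gxy.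
exists (g (d / 2)); split.
- exact: (geodesic_mdistl gxy).
- by rewrite metric_sym (geodesic_mdistr gxy)//; rewrite -/d; lra.
move=> a b h hxy.
have [u xu] := carried_ex (q x); have [v yv] := carried_ex (q y).
have [w mw] := carried_ex (q (g (d / 2))).
have [z [zuv zuw zvw]] := tree_median u v w.
have [t tab tz] := path_meets_separator qJ hxy xu yv zuv.
have p1 : is_path x (g (d / 2)) 0 (d / 2) g.
  have := geodesic_is_path (s := 0) (t := d / 2) gxy.
  by rewrite g0; apply; rewrite -/d; lra.
have p2 : is_path (g (d / 2)) y (d / 2) d g.
  have := geodesic_is_path (s := d / 2) (t := d) gxy.
  by rewrite g1; apply; rewrite -/d; lra.
have [t1 + t1z] := path_meets_separator qJ p1 xu mw zuw.
have [t2 + t2z] := path_meets_separator qJ p2 mw yv (separates_sym zvw).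
rewrite !in_itv/= => /andP[t2d t2d'] /andP[t10 t1d].
exists t => //.
have tt1 := close _ _ _ tz t1z.
have := close _ _ _ t1z t2z; rewrite gi ?in_d//; [|lra|lra].
rewrite ler0_norm; last lra.
move=> t12.
have t1m : mdist (g t1) (g (d / 2)) = d / 2 - t1.
  by rewrite gi ?in_d ?ler0_norm//; lra.
have := metric_triangle (h t) (g t1) (g (d / 2)); lra.
Qed.

(** * Consequences of the Bottleneck Property *)

Lemma geodesic_sym (R : realType) (Y : metricType R) (x y : Y) (g : R -> Y) :
  geodesic x y g -> geodesic y x (fun t => g (mdist x y - t)).
Proof.
move=> [g0 g1 gi]; rewrite /geodesic (metric_sym y x) subr0 subrr.
split=> // s t.
rewrite !in_itv/= => /andP[? ?] /andP[? ?].
rewrite gi ?in_itv/=; [|apply/andP; split; lra|apply/andP; split; lra].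
by rewrite distrC; congr `|_|; lra.
Qed.

Lemma geodesic_prefix (R : realType) (Y : metricType R) (x y : Y) (g : R -> Y)
    (t : R) : geodesic x y g -> t \in `[0, mdist x y] -> geodesic x (g t) g.
Proof.
move=> gxy td; rewrite /geodesic (geodesic_mdistl gxy td).
case: gxy => g0 g1 gi; split=> // s r; move: td.
rewrite !in_itv/= => /andP[? ?] /andP[? ?] /andP[? ?].
by apply: gi; rewrite in_itv/=; apply/andP; split; lra.
Qed.

Definition bottleneck_at (R : realType) (Y : metricType R) (D : R)
    (z x y : Y) : Prop :=
  forall (a b : R) (h : R -> Y), is_path x y a b h ->
    exists2 t : R, t \in `[a, b] & mdist (h t) z < D.

Lemma bottleneck_at_sym (R : realType) (Y : metricType R) (D : R) (z x y : Y) :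
  bottleneck_at D z x y -> bottleneck_at D z y x.
Proof.
move=> H a b h /is_path_sym/H[t tab tz]; exists (- t) => //.
move: tab; rewrite !in_itv/= => /andP[? ?]; apply/andP; split; lra.
Qed.

(** The geodesic g is itself a path, so it comes within D of m; comparing
    distances to x shows that its midpoint is within 2D of m. *)
Lemma geodesic_midpoint_bottleneck (R : realType) (Y : metricType R)
    (D : R) (x y m : Y) (g : R -> Y) :
  mdist x m = mdist x y / 2 -> bottleneck_at D m x y -> geodesic x y g ->
  bottleneck_at (3 * D) (g (mdist x y / 2)) x y.
Proof.
move=> xm bm gxy a b h hxy.
have d0 := mdist_ge0 x y; have [g0 g1 gi] := gxy.
have [s sab hs] := bm _ _ _ hxy.
have := geodesic_is_path (s := 0) (t := mdist x y) gxy (lexx _) d0 (lexx _).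
rewrite g0 g1 => /bm[t td gt].
have d2 : mdist x y / 2 \in `[0, mdist x y].
  by rewrite in_itv/=; apply/andP; split; lra.
have xt := geodesic_mdistl gxy td.
have gtd : mdist (g t) (g (mdist x y / 2)) < D.
  rewrite gi// ltr_norml; apply/andP; split.
    by have := metric_triangle x (g t) m; lra.
  by have := metric_triangle x m (g t); rewrite (metric_sym m); lra.
exists s => //.
have := metric_triangle (h s) m (g (mdist x y / 2)).
have := metric_triangle m (g t) (g (mdist x y / 2)).
by rewrite (metric_sym m (g t)); lra.
Qed.

(** For t <= d(x,y)/2, the point g t is the midpoint of g 0 and g (2t). A path
    h from x to y, continued backwards along g from y to g (2t), therefore comes
    near g t; the added piece of g is at distance at least t from g t, so if it
    is that piece which comes near, then t < D and the point x of h is already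
    near enough. The other half of g follows by symmetry. *)
Lemma geodesic_bottleneck (R : realType) (Y : metricType R) (D : R) :
  (forall (x y : Y) g, geodesic x y g ->
     bottleneck_at D (g (mdist x y / 2)) x y) ->
  forall (x y : Y) g t, geodesic x y g -> t \in `[0, mdist x y] ->
     bottleneck_at D (g t) x y.
Proof.
move=> mid.
have half (x y : Y) g t : geodesic x y g -> 0 <= t -> t <= mdist x y / 2 ->
    bottleneck_at D (g t) x y.
  move=> gxy t0 td a b h hxy.
  have [g0 g1 gi] := gxy; set d := mdist x y in td g1 gi *.
  have t2d : 2 * t \in `[0, d] by rewrite in_itv/=; apply/andP; split; lra.
  have tail : is_path y (g (2 * t)) (- d) (- (2 * t)) (fun s => g (- s)).
    apply: is_path_sym; rewrite -g1.
    by apply: (geodesic_is_path gxy); rewrite -/d; lra.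
  pose P w := (exists2 s, s \in `[a, b] & w = h s) \/
              (exists2 s, s \in `[2 * t, d] & w = g s).
  have Ph s : s \in `[a, b] -> P (h s) by left; exists s.
  have Pg s : s \in `[- d, - (2 * t)] -> P (g (- s)).
    rewrite in_itv/= => /andP[? ?]; right; exists (- s) => //.
    by rewrite in_itv/=; apply/andP; split; lra.
  have [c [e [k [kP kE]]]] := is_path_trans hxy Ph tail Pg.
  have := mid _ _ _ (geodesic_prefix gxy t2d).
  rewrite (geodesic_mdistl gxy t2d) (_ : 2 * t / 2 = t); last by lra.
  move=> /(_ _ _ _ kP)[s sce ks]; have [[r rab kr]|[r + kr]] := kE s sce.
    by exists r; rewrite // -kr.
  rewrite in_itv/= => /andP[tr rd].
  have ab : a <= b by have [] := hxy.
  exists a; first by rewrite in_itv/= lexx.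
  have -> : h a = g 0 by rewrite g0; have [] := hxy.
  have in_d v : 0 <= v -> v <= d -> v \in `[0, d].
    by rewrite in_itv/= => -> ->.
  move: ks; rewrite kr gi ?in_d//; [|lra|lra]; rewrite ger0_norm; last lra.
  rewrite gi ?in_d// ?sub0r ?normrN ?ger0_norm//; lra.
move=> x y g t gxy; rewrite in_itv/= => /andP[t0 td].
have [tle|tgt] := leP t (mdist x y / 2); first exact: half.
apply: bottleneck_at_sym.
have := half y x _ (mdist x y - t) (geodesic_sym gxy).
rewrite (metric_sym y x) subKr; apply; lra.
Qed.

(** The geodesic from x to y and the path from x to y through p formed by two
    geodesics are compared at the point z = g s with s = (p|y)_x. The path
    through p comes near z, on either of its two legs, and both cases give
    d(p,z) <= (x|y)_p + 2D because (p|y)_x + (x|y)_p = d(p,x) and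
    (p|x)_y + (x|y)_p = d(p,y). Finally h comes near z. *)
Lemma path_gromov_product (R : realType) (Y : metricType R) (D : R) :
  geodesic_space Y ->
  (forall (x y : Y) g t, geodesic x y g -> t \in `[0, mdist x y] ->
     bottleneck_at D (g t) x y) ->
  forall (p x y : Y) a b h, is_path x y a b h ->
  exists2 t, t \in `[a, b] &
    2 * mdist p (h t) < mdist p x + mdist p y - mdist x y + 6 * D.
Proof.
move=> hY bn p x y a b h hxy.
have [g gxy] := hY x y; have [g1 g1P] := hY x p; have [g2 g2P] := hY p y.
pose s := (mdist x p + mdist x y - mdist p y) / 2.
have sd : s \in `[0, mdist x y].
  rewrite in_itv/=; apply/andP; split.
    by have := metric_triangle p x y; rewrite (metric_sym p x) /s; lra.
  by have := metric_triangle x y p; rewrite (metric_sym y p) /s; lra.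
have zxy := bn _ _ _ _ gxy sd.
have [t tab tz] := zxy _ _ _ hxy; exists t => //.
have P1 : is_path x p 0 (mdist x p) g1.
  have [e0 e1 _] := g1P; rewrite -{1}e0 -{1}e1.
  by apply: (geodesic_is_path g1P); rewrite ?lexx ?mdist_ge0.
have P2 : is_path p y 0 (mdist p y) g2.
  have [e0 e1 _] := g2P; rewrite -{1}e0 -{1}e1.
  by apply: (geodesic_is_path g2P); rewrite ?lexx ?mdist_ge0.
have [c [e [k [kP kE]]]] := is_path_trans
  (P := fun w => (exists2 u, u \in `[0, mdist x p] & w = g1 u) \/
                 (exists2 u, u \in `[0, mdist p y] & w = g2 u))
  P1 (fun u ud => or_introl (ex_intro2 _ _ u ud erefl))
  P2 (fun u ud => or_intror (ex_intro2 _ _ u ud erefl)).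
have [r rce kr] := zxy _ _ _ kP.
have pz : mdist p (g s) < mdist p x - s + 2 * D.
  have := metric_triangle p (k r) (g s).
  have [[u ud E]|[u ud E]] := kE r rce; rewrite E in kr *.
    have := geodesic_mdistl g1P ud; have := geodesic_mdistr g1P ud.
    have := geodesic_mdistl gxy sd; have := metric_triangle x (g1 u) (g s).
    rewrite (metric_sym p (g1 u)) (metric_sym p x); lra.
  have := geodesic_mdistl g2P ud; have := geodesic_mdistr g2P ud.
  have := geodesic_mdistr gxy sd; have := metric_triangle (g s) (g2 u) y.
  rewrite (metric_sym (g s) (g2 u)) (metric_sym p x) /s; lra.
have := metric_triangle p (g s) (h t); rewrite (metric_sym (g s) (h t)).
have : 2 * s = mdist p x + mdist x y - mdist p y.
  by rewrite /s (metric_sym x p); lra.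
by lra.
Qed.

(** * Components of complements of balls *)

(** The path components of the complement of the open ball of radius r around p;
    path components rather than connected ones, because the Bottleneck Property
    speaks of paths. *)
Definition joined_outside (R : realType) (Y : metricType R) (p : Y) (r : R)
    (x y : Y) : Prop :=
  exists a b h, is_path x y a b h /\
    forall t, t \in `[a, b] -> r <= mdist p (h t).

Lemma joined_outside_refl (R : realType) (Y : metricType R) (p : Y) (r : R)
    (x : Y) : r <= mdist p x -> joined_outside p r x x.
Proof.
move=> rx; exists 0, 0, (fun=> x); split=> //; split=> //.
apply/within_itv_continuousP => t _ e e0.
by exists 1 => // s _ _; rewrite mdistxx.
Qed.

Lemma joined_outside_sym (R : realType) (Y : metricType R) (p : Y) (r : R)
    (x y : Y) : joined_outside p r x y -> joined_outside p r y x.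
Proof.
move=> [a [b [h [/is_path_sym P H]]]].
exists (- b), (- a), (fun t => h (- t)); split=> // t.
rewrite in_itv/= => /andP[? ?]; apply: H; rewrite in_itv/=.
by apply/andP; split; lra.
Qed.

Lemma joined_outside_trans (R : realType) (Y : metricType R) (p : Y) (r : R)
    (y x z : Y) :
  joined_outside p r x y -> joined_outside p r y z -> joined_outside p r x z.
Proof.
move=> [a [b [h [P H]]]] [a' [b' [h' [P' H']]]].
exact: (is_path_trans (P := fun w => r <= mdist p w) P H P' H').
Qed.

Lemma joined_outside_le (R : realType) (Y : metricType R) (p : Y) (r r' : R)
    (x y : Y) : r' <= r -> joined_outside p r x y -> joined_outside p r' x y.
Proof.
move=> rr [a [b [h [P H]]]]; exists a, b, h; split=> // t tab.
exact: le_trans (H t tab).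
Qed.

Lemma joined_outside_ge (R : realType) (Y : metricType R) (p : Y) (r : R)
    (x y : Y) : joined_outside p r x y -> r <= mdist p y.
Proof.
move=> [a [b [h [[ab _ _ <-] H]]]]; apply: H.
by rewrite in_itv/= lexx ab.
Qed.

Lemma joined_outside_geodesic (R : realType) (Y : metricType R) (p : Y) (r : R)
    (x y : Y) :
  geodesic_space Y -> r <= Num.max 0 (mdist p x - mdist x y) ->
  joined_outside p r x y.
Proof.
move=> hY rx; have [g gxy] := hY x y; exists 0, (mdist x y), g; split.
  have [e0 e1 _] := gxy; rewrite -{1}e0 -{1}e1.
  by apply: (geodesic_is_path gxy); rewrite ?lexx ?mdist_ge0.
move=> t td; rewrite (le_trans rx)// ge_max mdist_ge0/=.
have := geodesic_mdistl gxy td; have := metric_triangle p (g t) x.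
move: td; rewrite (metric_sym (g t) x) in_itv/= => /andP[? ?]; lra.
Qed.

(** Following a geodesic towards p, one can descend within a component down to
    the sphere that bounds it. *)
Lemma joined_outside_sphere (R : realType) (Y : metricType R) (p : Y) (r : R)
    (x : Y) :
  geodesic_space Y -> 0 <= r -> r <= mdist p x ->
  exists2 y, mdist p y = r & joined_outside p r y x.
Proof.
move=> hY r0 rx; have [g gpx] := hY p x.
exists (g r); first by apply: (geodesic_mdistl gpx); rewrite in_itv/= r0.
exists r, (mdist p x), g; split.
  by have := geodesic_is_path gpx r0 rx (lexx _); have [_ -> _] := gpx.
move=> t; rewrite in_itv/= => /andP[rt td].
by rewrite (geodesic_mdistl gpx)// in_itv/= td (le_trans r0).
Qed.

(** * Trees given by a parent relation *)

Definition child_adj (V : eqType) (child : rel V) : rel V :=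
  fun u v => child u v || child v u.

Lemma child_adj_sym (V : eqType) (child : rel V) : symmetric (child_adj child).
Proof. by move=> u v; rewrite /child_adj orbC. Qed.

Lemma child_adj_irrefl (V : eqType) (child : rel V) (lev : V -> nat) :
  (forall u v, child u v -> lev u = (lev v).+1) ->
  irreflexive (child_adj child).
Proof.
move=> lc u; rewrite /child_adj orbb; apply/negP => /lc /eqP.
by rewrite -{1}(add1n (lev u)) -{1}(add0n (lev u)) eqn_add2r.
Qed.

Lemma child_adj_connected (V : eqType) (child : rel V) (lev : V -> nat) :
  (forall u v, child u v -> lev u = (lev v).+1) ->
  (forall u, lev u <> 0%N -> exists v, child u v) ->
  (forall u v, lev u = 0%N -> lev v = 0%N -> u = v) ->
  forall u v, exists2 p, path (child_adj child) u p & v = last u p.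
Proof.
move=> lc par root.
have up u : exists p, path (child_adj child) u p /\ lev (last u p) = 0%N.
  have [n] := ubnP (lev u); elim: n u => // n IH u un.
  have [u0|/eqP/par[v uv]] := eqVneq (lev u) 0%N; first by exists [::].
  have [|p [vp p0]] := IH v; first by rewrite -ltnS -(lc _ _ uv).
  by exists (v :: p); rewrite /= vp /child_adj uv.
move=> u v; have [p [pu p0]] := up u; have [q [qv q0]] := up v.
have [r [ru lr _]] := walk_rev (@child_adj_sym V child) qv (root _ _ q0 p0).
by exists (p ++ r); rewrite ?cat_path ?pu// last_cat lr.
Qed.

(** A vertex of highest level on a cycle has both its neighbours as parents, so
    that they coincide. *)
Lemma child_adj_acyclic (V : eqType) (child : rel V) (lev : V -> nat) :
  (forall u v, child u v -> lev u = (lev v).+1) ->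
  (forall u v v', child u v -> child u v' -> v = v') ->
  forall c, ucycle (child_adj child) c -> (size c <= 2)%N.
Proof.
move=> lc uniqpar c cyc; rewrite leqNgt; apply/negP => c2.
have [v vc vmax] : exists2 v, v \in c & {in c, forall w, (lev w <= lev v)%N}.
  case: c c2 {cyc} => // v0 c _.
  elim: c v0 => [|w c IH] v0.
    by exists v0; rewrite ?mem_head// => w; rewrite inE => /eqP ->.
  have [v vc vm] := IH w; have [le|lt] := leqP (lev v0) (lev v).
    exists v; first by rewrite inE vc orbT.
    by move=> x; rewrite inE => /predU1P[->|/vm].
  exists v0; first exact: mem_head.
  by move=> x; rewrite inE => /predU1P[->//|/vm/leq_trans]; apply; exact: ltnW.
have [i s E] := rot_to vc.
have : ucycle (child_adj child) (v :: s) by rewrite -E rot_ucycle.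
have vs w : w \in s -> child_adj child v w -> child v w.
  move=> ws /orP[//|/lc wv].
  have : w \in c by rewrite -(mem_rot i) E inE ws orbT.
  by move=> /vmax; rewrite wv ltnn.
have : (2 <= size s)%N.
  by rewrite -ltnS -[(size s).+1]/(size (v :: s)) -E size_rot.
case: s vs {E} => [|a [|b s]]// vs _ /andP[/=].
rewrite rcons_path => /and3P[va _ /andP[_ lv]] /and3P[_ + _].
suff -> : a = last b s by rewrite mem_last.
apply: (uniqpar v); first by apply: vs; rewrite ?mem_head.
by apply: vs; [rewrite inE mem_last orbT|rewrite child_adj_sym].
Qed.

Definition child_tree (V : eqType) (child : rel V) (lev : V -> nat)
    (lc : forall u v, child u v -> lev u = (lev v).+1)
    (uniqpar : forall u v v', child u v -> child u v' -> v = v')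
    (par : forall u, lev u <> 0%N -> exists v, child u v)
    (root : forall u v, lev u = 0%N -> lev v = 0%N -> u = v) : simplicialTree :=
  SimplicialTree (child_adj_sym child) (child_adj_irrefl lc)
    (child_adj_connected lc par root) (child_adj_acyclic lc uniqpar).

(** * Lipschitz functions on the realization *)

(** Both sums reduce to the support of b, which lies in both simplices: the
    affine extension of f is well defined. *)
Lemma bary_sum_indep (R : realType) (G : simplicialTree) (b : vertex G -> R)
    (s s' : seq (vertex G)) (f : vertex G -> R) :
  bary_on s b -> bary_on s' b ->
  \sum_(w <- s) b w * f w = \sum_(w <- s') b w * f w.
Proof.
move=> [hs _ b0 _] [hs' _ b0' _].
have supp t : \sum_(w <- t) b w * f w = \sum_(w <- t | b w != 0) b w * f w.
  rewrite big_mkcond [RHS]big_mkcond/=; apply: eq_bigr => w _.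
  by case: eqVneq => // ->; rewrite mul0r.
rewrite supp [RHS]supp -big_filter -[RHS]big_filter; apply: perm_big.
apply: uniq_perm; rewrite ?filter_uniq ?simplex_uniq// => w.
rewrite !mem_filter; case: eqVneq => //= bw.
have -> : w \in s by apply: contraNT bw => /b0 ->.
by have -> : w \in s' by apply: contraNT bw => /b0' ->.
Qed.

(** The affine extension of f is 1-Lipschitz on each simplex, hence along
    piecewise linear paths. It is written out as a sum over a simplex instead of
    as a function on the realization, which would require choosing a simplex for
    each point. *)
Lemma pl_path_lipschitz (R : realType) (G : simplicialTree) (f : vertex G -> R)
    (x y : realization R G) (l : R) (s s' : seq (vertex G)) :
  (forall u v, adj u v -> `|f u - f v| <= 1) ->
  pl_path x y l -> bary_on s (bary x) -> bary_on s' (bary y) ->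
  `|\sum_(w <- s) bary x w * f w - \sum_(w <- s') bary y w * f w| <= l.
Proof.
move=> f1 xy; elim: xy s s' => [a|t a b c k ta tb _ IH] s s' xs ys.
  by rewrite (bary_sum_indep f xs ys) subrr normr0.
rewrite (bary_sum_indep f xs ta).
apply: le_trans (ler_distD (\sum_(w <- t) bary b w * f w) _ _) _.
apply: lerD; last exact: IH.
rewrite /simplex_dist; case: t ta tb => [[]//|u [|v [|? ?]]] [//ht _ _ +].
  rewrite !big_seq1 => -> [_ _ _]; rewrite !big_seq1 => ->.
  by rewrite !subrr normr0 mulr0.
rewrite !big_cons !big_nil !addr0 => xu [_ _ _].
rewrite !big_cons !big_nil !addr0 => yu.
have -> : bary a v - bary b v = - (bary a u - bary b u) by lra.
have -> : bary a u * f u + bary a v * f v - (bary b u * f u + bary b v * f v) =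
    (bary a u - bary b u) * (f u - f v).
  have -> : bary a v = 1 - bary a u by lra.
  have -> : bary b v = 1 - bary b u by lra.
  by rewrite !mulrBl !mulrBr; lra.
rewrite normrN normrM.
have := ler_wpM2l (normr_ge0 (bary a u - bary b u)) (f1 _ _ ht); lra.
Qed.

(** The source of lower bounds for distances in the tree: a distance is the
    infimum of the lengths of paths, and a 1-Lipschitz function bounds each of
    them from below. *)
Lemma vertex_point_lipschitz (R : realType) (G : simplicialTree)
    (f : vertex G -> R) (u v : vertex G) :
  (forall u v, adj u v -> `|f u - f v| <= 1) ->
  `|f u - f v| <= mdist (vertex_point R u) (vertex_point R v).
Proof.
move=> f1; apply: lb_le_inf; first exact: pl_path_ex.
move=> l /= uv.
have on (w : vertex G) : bary_on [:: w] (bary (vertex_point R w)).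
  exact: bary_on_vertex (mem_head _ _).
have := pl_path_lipschitz f1 uv (on u) (on v).
by rewrite !big_seq1/= !eqxx !mul1r.
Qed.

Lemma adj_mdist_le1 (R : realType) (G : simplicialTree) (u v : vertex G) :
  adj u v -> mdist (vertex_point R u) (vertex_point R v) <= 1.
Proof.
move=> uv.
have us : bary_on [:: u; v] (bary (vertex_point R u)).
  by apply: bary_on_vertex => //; exact: mem_head.
have vs : bary_on [:: u; v] (bary (vertex_point R v)).
  by apply: bary_on_vertex => //; rewrite !inE eqxx orbT.
exact: le_trans (mdist_le_pl_path (pl_path1 us vs)) (simplex_dist_le1 us vs).
Qed.

(** * The tree of components *)

(** Only components that reach the annulus just above their level are vertices
    by definition; by descending along geodesics towards p, every component is
    of this kind [component_vertex_ex]. *)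
Definition component_vertex (R : realType) (Y : metricType R) (p : Y) :=
  {v : nat * set Y | `[< exists2 x, v.1%:R <= mdist p x < v.1.+1%:R &
                           v.2 = [set y | joined_outside p v.1%:R x y] >]}.

Definition level (R : realType) (Y : metricType R) (p : Y)
    (v : component_vertex p) : nat := (val v).1.

Definition points (R : realType) (Y : metricType R) (p : Y)
    (v : component_vertex p) : set Y := (val v).2.

Lemma points_rep (R : realType) (Y : metricType R) (p : Y)
    (v : component_vertex p) :
  exists2 x, points v x & (level v)%:R <= mdist p x < (level v).+1%:R.
Proof.
have /asboolP[x xn E] := valP v; exists x => //.
rewrite /points E; apply: joined_outside_refl.
by have /andP[] := xn.
Qed.

Lemma points_joined (R : realType) (Y : metricType R) (p : Y)
    (v : component_vertex p) (x y : Y) :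
  points v x -> points v y <-> joined_outside p (level v)%:R x y.
Proof.
rewrite /points /level; have /asboolP[z zn ->] /= := valP v => zx; split.
  by move=> zy; apply: joined_outside_trans zy; exact: joined_outside_sym.
exact: joined_outside_trans zx.
Qed.

Lemma points_ge (R : realType) (Y : metricType R) (p : Y)
    (v : component_vertex p) (x : Y) : points v x -> (level v)%:R <= mdist p x.
Proof. by move=> vx; have /(points_joined _ vx)/joined_outside_ge := vx. Qed.

Lemma component_vertex_inj (R : realType) (Y : metricType R) (p : Y)
    (u v : component_vertex p) (x : Y) :
  level u = level v -> points u x -> points v x -> u = v.
Proof.
move=> uv ux vx; apply: val_inj.
rewrite [LHS]surjective_pairing [RHS]surjective_pairing; congr (_, _) => //.
apply/seteqP; split=> y.
  by move/(points_joined _ ux); rewrite uv => /(points_joined _ vx).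
by move/(points_joined _ vx); rewrite -uv => /(points_joined _ ux).
Qed.

Lemma component_vertex_ex (R : realType) (Y : metricType R) (p : Y) (n : nat)
    (x : Y) :
  geodesic_space Y -> n%:R <= mdist p x ->
  exists v : component_vertex p, level v = n /\ points v x.
Proof.
move=> hY nx; have [y py yx] := joined_outside_sphere hY (ler0n R n) nx.
have P : `[< exists2 z, n%:R <= mdist p z < n.+1%:R &
    [set w | joined_outside p n%:R y w] =
    [set w | joined_outside p n%:R z w] >].
  by apply/asboolP; exists y => //; rewrite py lexx ltr_nat ltnS leqnn.
by exists (exist _ (n, [set w | joined_outside p n%:R y w]) P).
Qed.

Definition component_child (R : realType) (Y : metricType R) (p : Y) :
    rel (component_vertex p) :=
  fun u v => (level u == (level v).+1) &&
             `[< exists x, points u x /\ points v x >].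

Lemma component_child_level (R : realType) (Y : metricType R) (p : Y)
    (u v : component_vertex p) : component_child u v -> level u = (level v).+1.
Proof. by move=> /andP[/eqP]. Qed.

Lemma component_child_unique (R : realType) (Y : metricType R) (p : Y)
    (u v v' : component_vertex p) :
  component_child u v -> component_child u v' -> v = v'.
Proof.
move=> /andP[/eqP uv /asboolP[x [ux vx]]] /andP[/eqP uv' /asboolP[y [uy vy]]].
have vv' : level v = level v' by apply/eqP; rewrite -eqSS -uv uv'.
apply: (component_vertex_inj vv' vx).
apply/(points_joined _ vy)/joined_outside_sym.
move/(points_joined _ ux): uy; apply: joined_outside_le.
by rewrite uv' ler_nat.
Qed.

Lemma component_child_ex (R : realType) (Y : metricType R) (p : Y)
    (u : component_vertex p) :
  geodesic_space Y -> level u <> 0%N -> exists v, component_child u v.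
Proof.
move=> hY; case E : (level u) => [//|n] _.
have [x ux /andP[nx _]] := points_rep u.
have [|v [vn vx]] := component_vertex_ex (p := p) (n := n) (x := x) hY.
  by apply: le_trans nx; rewrite E ler_nat.
by exists v; rewrite /component_child E vn eqxx/=; apply/asboolP; exists x.
Qed.

Lemma component_root_unique (R : realType) (Y : metricType R) (p : Y)
    (u v : component_vertex p) :
  geodesic_space Y -> level u = 0%N -> level v = 0%N -> u = v.
Proof.
move=> hY u0 v0; have [x ux _] := points_rep u; have [y vy _] := points_rep v.
apply: (@component_vertex_inj _ _ _ _ _ x) => //; first by rewrite u0.
apply/(points_joined _ vy); apply: joined_outside_geodesic => //.
by rewrite v0 le_max lexx.
Qed.

Definition component_tree (R : realType) (Y : metricType R) (p : Y)
    (hY : geodesic_space Y) : simplicialTree :=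
  child_tree (@component_child_level R Y p) (@component_child_unique R Y p)
    (fun u => @component_child_ex R Y p u hY)
    (fun u v => @component_root_unique R Y p u v hY).

(** Climbing down through the components of x, one level per edge. *)
Lemma ancestor_mdist_le (R : realType) (Y : metricType R) (p : Y)
    (hY : geodesic_space Y) (u v : vertex (component_tree p hY)) (x : Y)
    (j : nat) :
  level u = (level v + j)%N -> points u x -> points v x ->
  mdist (vertex_point R u) (vertex_point R v) <= j%:R.
Proof.
elim: j u => [|j IH] u uv ux vx.
  by rewrite addn0 in uv; rewrite (component_vertex_inj uv ux vx) mdistxx.
have [|w [wl wx]] :=
  component_vertex_ex (p := p) (n := (level v + j)%N) (x := x) hY.
  by apply: le_trans (points_ge ux); rewrite uv ler_nat addnS.
have uw : @adj (component_tree p hY) u w.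
  apply/orP; left; rewrite /component_child uv wl addnS eqxx/=.
  by apply/asboolP; exists x.
apply: le_trans (metric_triangle (vertex_point R u)
  (vertex_point R (w : vertex (component_tree p hY))) (vertex_point R v)) _.
by rewrite -addn1 natrD addrC lerD ?IH ?adj_mdist_le1.
Qed.

(** The lower bound comes from the functions v |-> d(x, rep v) / L, which are
    1-Lipschitz on the tree; the upper bound from the component, at the level k
    just below d(p,x) - d(x,y), that contains x and y. *)
Lemma bottleneck_quasi_tree (R : realType) (Y : metricType R) (p : Y)
    (hY : geodesic_space Y) :
  bottleneck_property Y ->
  quasi_isometric Y (realization R (component_tree p hY)).
Proof.
move=> [D D0 hD].
have bn (x y : Y) g t : geodesic x y g -> t \in `[0, mdist x y] ->
    bottleneck_at (3 * D) (g t) x y.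
  apply: geodesic_bottleneck => {}x {}y {}g gxy.
  have [m [xm ym bm]] := hD x y.
  exact: geodesic_midpoint_bottleneck xm bm gxy.
pose C := 18 * D.
have close r x y : joined_outside p r x y ->
    mdist x y <= mdist p x + mdist p y - 2 * r + C.
  move=> [a [b [h [hxy hr]]]].
  have [t tab] := path_gromov_product hY bn p hxy.
  by have := hr t tab; rewrite /C; lra.
pose G := component_tree p hY.
have /choice[rep repP] (v : component_vertex p) :
    exists x, points v x /\ (level v)%:R <= mdist p x < (level v).+1%:R.
  by have [x vx xl] := points_rep v; exists x.
have /choice[q qP] (x : Y) : exists v : component_vertex p,
    level v = Num.truncn (mdist p x) /\ points v x.
  by apply: component_vertex_ex; rewrite // truncn_le mdist_ge0.
(* 3: a point of the parent component and one of the child component are at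
   heights less than n + 1 and n + 2, where n is the level of the parent *)
pose L := 3 + C.
have C0 : 0 <= C by rewrite mulr_ge0// ltW.
have L0 : 0 < L by rewrite /L; lra.
have child_close (u v : component_vertex p) : component_child u v ->
    mdist (rep u) (rep v) <= L.
  move=> /andP[/eqP uv /asboolP[x [ux vx]]].
  have [ru /andP[_ ru1]] := repP u; have [rv /andP[_ rv1]] := repP v.
  have : joined_outside p (level v)%:R (rep u) (rep v).
    apply: (@joined_outside_trans _ _ _ _ x).
      move/(points_joined _ ru): ux; apply: joined_outside_le.
      by rewrite uv ler_nat.
    exact/(points_joined _ vx).
  move/close; move: ru1 rv1; rewrite uv /L.
  by rewrite -!(addn1 _.+1) -!(addn1 (level v)) !natrD; lra.
have self_close x : mdist x (rep (q x)) <= L.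
  have [qx xq] := qP x; have [rq /andP[_ rq1]] := repP (q x).
  have /(points_joined _ xq)/close := rq.
  have := truncnS_gt (mdist p x); rewrite -qx.
  move: rq1; rewrite -(addn1 (level _)) natrD /L; lra.
exists L, 2; split; [by rewrite /L; lra|by []|].
exists (fun x => vertex_point R (q x : vertex G)); split; last first.
  move=> y; have [v yv] := carried_ex y; exists (rep v).
  have [rv rvl] := repP v; have [qv vq] := qP (rep v).
  have -> : q (rep v) = v.
    by apply: (component_vertex_inj _ vq rv); rewrite qv; exact: truncn_def.
  by apply: le_trans (carried_mdist_le1 yv) _; rewrite ler1n.
move=> x y; have d0 := mdist_ge0 x y; apply/andP; split.
  have f1 (u v : vertex G) : adj u v ->
      `|mdist x (rep u) / L - mdist x (rep v) / L| <= 1.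
    move=> uv; have {}uv : mdist (rep u) (rep v) <= L.
      by case/orP: uv => /child_close//; rewrite metric_sym.
    rewrite -mulrBl normrM (gtr0_norm (x := L^-1)) ?invr_gt0//.
    rewrite ler_pdivrMr// mul1r ler_norml; apply/andP; split.
      by have := metric_triangle x (rep u) (rep v); lra.
    have := metric_triangle x (rep v) (rep u).
    rewrite (metric_sym (rep v)); lra.
  pose f (v : vertex G) := mdist x (rep v) / L.
  have := @vertex_point_lipschitz R G f (q x) (q y) f1.
  rewrite /f -mulrBl normrM (gtr0_norm (x := L^-1)) ?invr_gt0//.
  apply: le_trans.
  rewrite -(ler_pM2r L0) mulrBl divfK ?gt_eqF// divfK ?gt_eqF//.
  rewrite ler_normr; apply/orP; right.
  have := self_close x; have := self_close y.
  have := metric_triangle x (rep (q y)) y.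
  rewrite (metric_sym (rep (q y))); lra.
pose k := Num.truncn (Num.max 0 (mdist p x - mdist x y)).
have k0 : k%:R <= Num.max 0 (mdist p x - mdist x y).
  by rewrite truncn_le le_max lexx.
have k1 : mdist p x - mdist x y < k%:R + 1.
  rewrite natr1.
  have := truncnS_gt (Num.max 0 (mdist p x - mdist x y)); rewrite -/k.
  by apply: le_lt_trans; rewrite le_max lexx orbT.
have xy : joined_outside p k%:R x y by exact: joined_outside_geodesic.
have ky := joined_outside_ge xy.
have kx := joined_outside_ge (joined_outside_sym xy).
have [w [wk wx]] := component_vertex_ex hY kx.
have wy : points w y by apply/(points_joined _ wx); rewrite wk.
have climb z : points w z ->
    mdist (vertex_point R (q z : vertex G)) (vertex_point R (w : vertex G))
      <= mdist p z - k%:R.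
  move=> wz; have [ql qz] := qP z.
  have kz : (k <= level (q z))%N.
    by rewrite ql truncn_ge_nat ?mdist_ge0// -wk points_ge.
  have := @ancestor_mdist_le R Y p hY (q z) w z (level (q z) - k).
  rewrite wk subnKC// => /(_ erefl qz wz)/le_trans; apply.
  by rewrite natrB// lerB// ql truncn_le mdist_ge0.
have := climb x wx; have := climb y wy.
have := metric_triangle (vertex_point R (q x : vertex G))
  (vertex_point R (w : vertex G)) (vertex_point R (q y : vertex G)).
rewrite (metric_sym (vertex_point R (w : vertex G))).
have := metric_triangle p x y.
have : 3 * mdist x y <= L * mdist x y by rewrite ler_wpM2r// /L; lra.
lra.
Qed.

(** * The equivalence *)

(** Without a base point the construction has nothing to start from; the empty
    space corresponds to the empty tree. *)
Lemma empty_quasi_tree (R : realType) (Y : metricType R) :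
  (Y -> False) ->
  exists G : simplicialTree, quasi_isometric Y (realization R G).
Proof.
move=> Y0.
pose G := @SimplicialTree void (fun _ _ => false) (fun u => match u with end)
  (fun u => match u with end) (fun u => match u with end)
  (fun c => match c with [::] => fun _ => isT | u :: _ => match u with end end).
exists G, 1, 0; split=> //; exists (fun y => match Y0 y with end).
split=> [x|y]; first by have := Y0 x.
by have [u _] := carried_ex y; case: u.
Qed.

Theorem theorem4p6 (R : realType) (Y : metricType R) (hY : geodesic_space Y) :
  (exists G : simplicialTree, quasi_isometric Y (realization R G))
  <-> bottleneck_property Y.
Proof.
split=> [[G]|bY]; first exact: quasi_tree_bottleneck.
have [[p _]|Y0] := pselect (exists p : Y, True).
  by exists (component_tree p hY); exact: bottleneck_quasi_tree.
by apply: empty_quasi_tree => y; apply: Y0; exists y.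
Qed.
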